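(* The following functions of $x>0$ are completely monotonic: (a) $x^\lambda W(x)$, for $\lambda\le-1$; (b) $x^\lambda\, W^\alpha(x^\beta)\,[1+W(x^\beta)]^\gamma$, for $\alpha,\gamma\ge0$, $-1\le\beta\le0$, $\lambda\le0$; (c) $x^\lambda\, W^\alpha(x^{-\beta})\,[1+W(x^{-\beta})]^\gamma$, for $\alpha,\gamma\le0$, $-1\le\beta\le0$, $\lambda\le0$; (d) $1-x^{-\alpha\beta\gamma}\,W^{\alpha\gamma}(x^\beta)\,[1+W(x^\beta)]^{\gamma-1}$, for $0\le\alpha\le1$, $-1\le\beta\le0$, $0\le\gamma\le1$.
   Context: $W$ denotes the principal branch of the Lambert $W$ function; for $x>0$, $W(x)$ is the unique positive real number with $W(x)e^{W(x)}=x$. $W^\alpha(y)$ means $(W(y))^\alpha$. All exponents are real. A function $f:(0,\infty)\to\mathbb{R}$ is completely monotonic if it has derivatives of all orders and $(-1)^nf^{(n)}(x)\ge0$ for all $x>0$ and $n=0,1,2,\dots$. *)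

(* Defs.v *)
From Stdlib Require Import Reals Lra.
From Coquelicot Require Import Coquelicot.
Open Scope R_scope.

(* Principal branch of the Lambert W function on (0, +oo).  [iota] is
   Coquelicot's definite description: for [x <= 0] the value is unspecified. *)
Definition LambertW (x : R) : R :=
  iota (fun w : R => 0 < w /\ w * exp w = x).

(* Only the restriction of [f] to (0, +oo) matters: [Derive_n f n x] depends
   only on the values of [f] near [x]. *)
Definition completely_monotonic (f : R -> R) : Prop :=
  forall (n : nat) (x : R), 0 < x ->
    ex_derive_n f n x /\ 0 <= (-1) ^ n * Derive_n f n x.

Lemma LambertW_exists_unique (x : R) :
  0 < x -> exists! w : R, 0 < w /\ w * exp w = x.
Proof.
intros Hx.
destruct (IVT (fun w => w * exp w - x) 0 x) as [w [[H0 _] Hw]].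
- apply derivable_continuous; reg.
- exact Hx.
- lra.
- assert (1 + x < exp x) by (apply exp_ineq1; lra). nra.
- exists w; split.
  + split; [|lra].
    destruct H0 as [H0|H0]; [exact H0|]. subst w. lra.
  + intros v [Hv Ev].
    pose proof (exp_pos v). pose proof (exp_pos w).
    destruct (Rtotal_order w v) as [L|[E|L]]; [|exact E|];
      apply exp_increasing in L as L'; nra.
Qed.

Lemma LambertW_spec (x : R) :
  0 < x -> 0 < LambertW x /\ LambertW x * exp (LambertW x) = x.
Proof.
intros Hx; exact (iota_correct _ (LambertW_exists_unique x Hx)).
Qed.

(* Main.v *)
Require Import Defs.
From Stdlib Require Import Reals Lra Ranalysis5.
From Coquelicot Require Import Coquelicot.
Open Scope R_scope.

(** Put [w = W(x^b)] and [q = 1 / (1 + w)] ([Wpow b x] and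
    [Welast b x] below).  Since [ln w + w = b ln x], one has
    [x w' = b (1 - q)] and [x q' = - b q^2 (1 - q)], and every function
    of the theorem is built from the monomials [x^l w^a (1 + w)^c], whose
    logarithmic derivative is a polynomial in [q] divided by [x]:
      [(l + b (a q + c q (1 - q))) / x].

    The tool is the remark that a nonnegative [f] with [f' = - f h] and [h]
    completely monotonic is itself completely monotonic: by the Leibniz rule,
    the signs of the derivatives of [f] up to order [n] give the sign at order
    [n + 1] (lemma [cm_upto_of_log_derivative]).  It also works for systems:
    if finitely many nonnegative functions have derivatives that are minus a
    polynomial with nonnegative coefficients in these functions (and in other
    completely monotonic functions), all of them are completely monotonic, by
    simultaneous induction on the order.  Two such systems are enough, and
    they replace the theory of Stieltjes and Bernstein functions.

    - For [0 <= b <= 1], take [q] and [E = w' = b (1 - q) / x]: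
        [- q' = q^2 E] and [- E' = E ((1 - b) / x + E (1 + q))]
      (lemma [cm_upto_Welast_pos]).
    - For [-1 <= b <= 0], take [P = 1 - q] and [K = - b q^2 / x]:
        [- P' = K P] and [- K' = K ((1 + b) / x - b P^2 / x + K)]
      (lemma [cm_upto_Welast_neg]); then [T = q / x] satisfies
        [- T' = T ((1 + b) / x - b P / x + K)].

    For (a), (b) and (c), minus the logarithmic derivative of the monomial is
    a combination of these functions with nonnegative coefficients.  For (d),
    the function is [1 - g] with [g = exp (- alpha gamma w) (1 + w)^(gamma - 1)]
    at most [1], and [g'] is a nonnegative combination of two monomials to
    which the same criterion applies (lemma [cm_upto_one_sub_monomial]). *)

(** * Complete monotonicity up to a finite order *)

(** Stating the property order by order is what allows mutually dependent
    functions to be treated by induction on the order.  The witness [g] is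
    minus the derivative, so that it has to satisfy the same kind of sign
    conditions as [f]. *)
Fixpoint cm_upto (n : nat) (f : R -> R) : Prop :=
  (forall x, 0 < x -> 0 <= f x) /\
  match n with
  | O => True
  | S m => exists g, (forall x, 0 < x -> is_derive f x (- g x)) /\ cm_upto m g
  end.

Lemma locally_pos (x : R) (Q : R -> Prop) :
  0 < x -> (forall y, 0 < y -> Q y) -> locally x Q.
Proof.
intros Hx HQ.
apply (filter_imp (fun y => 0 < y)); [exact HQ|].
now apply (open_gt 0).
Qed.

Lemma cm_upto_nonneg n f x : cm_upto n f -> 0 < x -> 0 <= f x.
Proof. destruct n; intros [H _]; apply H. Qed.

Lemma cm_upto_step n f g :
  (forall x, 0 < x -> 0 <= f x) ->
  (forall x, 0 < x -> is_derive f x (- g x)) ->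
  cm_upto n g -> cm_upto (S n) f.
Proof. intros H0 H1 H2; split; [exact H0|]. now exists g. Qed.

Lemma cm_upto_pred n : forall f, cm_upto (S n) f -> cm_upto n f.
Proof.
induction n as [|n IH]; intros f [H0 [g [H1 H2]]].
- now split.
- apply (cm_upto_step n f g H0 H1), IH, H2.
Qed.

Lemma cm_upto_ext n f g :
  (forall x, 0 < x -> f x = g x) -> cm_upto n f -> cm_upto n g.
Proof.
intros E; destruct n as [|n]; intros [H0 H1]; split.
- intros x Hx; rewrite <- E by exact Hx; auto.
- exact I.
- intros x Hx; rewrite <- E by exact Hx; auto.
- destruct H1 as [d [H1 H2]]; exists d; split; [|exact H2].
  intros x Hx; apply is_derive_ext_loc with f; [|auto].
  now apply locally_pos.
Qed.

Lemma cm_upto_const n c : 0 <= c -> cm_upto n (fun _ => c).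
Proof.
revert c; induction n as [|n IH]; intros c Hc; [now split|].
apply cm_upto_step with (fun _ => 0); [auto| |apply IH; lra].
intros x _; auto_derive; [exact I|ring].
Qed.

Lemma cm_upto_plus n : forall f g,
  cm_upto n f -> cm_upto n g -> cm_upto n (fun x => f x + g x).
Proof.
induction n as [|n IH]; intros f g Hf Hg.
- split; [|exact I]. intros x Hx.
  pose proof (cm_upto_nonneg _ _ x Hf Hx).
  pose proof (cm_upto_nonneg _ _ x Hg Hx). lra.
- destruct Hf as [Hf [f' [Df Cf]]], Hg as [Hg [g' [Dg Cg]]].
  apply cm_upto_step with (fun x => f' x + g' x); [| |now apply IH].
  + intros x Hx. specialize (Hf x Hx); specialize (Hg x Hx); lra.
  + intros x Hx. replace (- (f' x + g' x)) with (- f' x + - g' x) by ring.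
    exact (is_derive_plus _ _ _ _ _ (Df x Hx) (Dg x Hx)).
Qed.

Lemma cm_upto_mult n : forall f g,
  cm_upto n f -> cm_upto n g -> cm_upto n (fun x => f x * g x).
Proof.
induction n as [|n IH]; intros f g Hf Hg.
- split; [|exact I]. intros x Hx.
  apply Rmult_le_pos; eapply cm_upto_nonneg; eauto.
- pose proof (cm_upto_pred _ _ Hf) as Pf; pose proof (cm_upto_pred _ _ Hg) as Pg.
  destruct Hf as [Hf [f' [Df Cf]]], Hg as [Hg [g' [Dg Cg]]].
  apply cm_upto_step with (fun x => f' x * g x + f x * g' x).
  + intros x Hx; apply Rmult_le_pos; auto.
  + intros x Hx.
    replace (- (f' x * g x + f x * g' x)) with (- f' x * g x + f x * - g' x)
      by ring.
    exact (is_derive_mult f g x _ _ (Df x Hx) (Dg x Hx) Rmult_comm).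
  + apply cm_upto_plus; now apply IH.
Qed.

(** In [- f' = f h] the right-hand side involves derivatives of [f] of one
    order less than the left-hand side, which is what an induction needs. *)
Lemma cm_upto_of_log_derivative n f h :
  (forall x, 0 < x -> 0 <= f x) ->
  (forall x, 0 < x -> is_derive f x (- (f x * h x))) ->
  (forall m, cm_upto m h) -> cm_upto n f.
Proof.
intros H0 H1 Hh; induction n as [|n IH]; [now split|].
apply (cm_upto_step n f _ H0 H1).
apply cm_upto_mult; auto.
Qed.

Lemma cm_upto_inv n : cm_upto n (fun x => / x).
Proof.
assert (H0 : forall x, 0 < x -> 0 <= / x).
{ intros x Hx; apply Rlt_le, Rinv_0_lt_compat, Hx. }
induction n as [|n IH]; [now split|].
apply cm_upto_step with (fun x => / x * / x); [exact H0| |].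
- intros x Hx; auto_derive; [lra|field; lra].
- now apply cm_upto_mult.
Qed.

(** [Derive f] and [- g] agree on the positive half-line only; this is enough
    because iterated derivatives at [x] depend only on the germ at [x]. *)
Lemma completely_monotonic_of_cm_upto f :
  (forall n, cm_upto n f) -> completely_monotonic f.
Proof.
intros H n; specialize (H n); revert f H.
induction n as [|n IH]; intros f H x Hx.
- split; [exact I|]. simpl; rewrite Rmult_1_l. exact (proj1 H x Hx).
- destruct H as [_ [g [Df Cg]]].
  destruct (IH g Cg x Hx) as [Eg Sg].
  assert (L : locally x (fun y => - g y = Derive f y)).
  { apply locally_pos; [exact Hx|]. intros y Hy.
    symmetry; now apply is_derive_unique, Df. }
  assert (D : forall k y, Derive_n f (S k) y = Derive_n (Derive f) k y).
  { intros k y. rewrite <- (Nat.add_1_r k). symmetry.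
    exact (Derive_n_comp f k 1 y). }
  split.
  + destruct n as [|n].
    { exists (- g x). now apply Df. }
    change (ex_derive (Derive_n f (S n)) x).
    apply ex_derive_ext with (Derive_n (Derive f) n).
    { intros y; symmetry; apply D. }
    exact (ex_derive_n_ext_loc _ _ (S n) x L (ex_derive_n_opp g (S n) x Eg)).
  + rewrite D, <- (Derive_n_ext_loc _ _ n x L), Derive_n_opp.
    simpl; lra.
Qed.

(** * Differentiating the Lambert function *)

Lemma mul_exp_increasing u v : 0 < u -> u < v -> u * exp u < v * exp v.
Proof.
intros Hu L. pose proof (exp_increasing _ _ L). pose proof (exp_pos u). nra.
Qed.

Lemma LambertW_le x y : 0 < x -> x <= y -> LambertW x <= LambertW y.
Proof.
intros Hx Hy.
destruct (LambertW_spec x Hx) as [P1 E1].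
destruct (LambertW_spec y ltac:(lra)) as [P2 E2].
apply Rnot_lt_le; intros L.
pose proof (mul_exp_increasing _ _ P2 L). lra.
Qed.

(** Inverse function theorem for [w exp w] on a compact interval around [x];
    there the derivative [(1 + w) exp w = x (1 + w) / w] does not vanish. *)
Lemma is_derive_LambertW x :
  0 < x -> is_derive LambertW x (LambertW x / (x * (1 + LambertW x))).
Proof.
intros Hx.
set (f := fun w => w * exp w).
assert (Df : forall w, derivable_pt_lim f w ((1 + w) * exp w)).
{ intros w. apply is_derive_Reals. unfold f. auto_derive; [exact I|ring]. }
set (lb := LambertW (x / 2)); set (ub := LambertW (2 * x)).
destruct (LambertW_spec (x / 2)) as [Hl El]; [lra|].
destruct (LambertW_spec (2 * x)) as [Hu Eu]; [lra|].
destruct (LambertW_spec x Hx) as [Hw Ew].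
fold lb in Hl, El; fold ub in Hu, Eu.
assert (Hlu : lb < ub).
{ assert (lb <= ub) as [L|E] by (apply LambertW_le; lra); [exact L|].
  rewrite E in El; lra. }
assert (C : continuity_pt LambertW x).
{ apply (continuity_pt_recip_interv f LambertW lb ub Hlu); unfold f.
  - intros u v H1 H2 _. apply mul_exp_increasing; lra.
  - rewrite El. intros y Hy _. apply (LambertW_spec y). lra.
  - rewrite El, Eu. intros y H1 H2; split; apply LambertW_le; lra.
  - intros a _. apply derivable_continuous_pt. exists ((1 + a) * exp a). apply Df.
  - rewrite El, Eu; lra. }
apply is_derive_Reals.
(* An explicit derivability proof, so that [derive_pt] computes. *)
set (Prf := fun a (_ : lb <= a <= ub) => exist (derivable_pt_abs f a) _ (Df a)).
assert (Hin : lb <= LambertW x <= ub) by (split; apply LambertW_le; lra).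
assert (DE : derive_pt f (LambertW x) (Prf (LambertW x) Hin)
             = (1 + LambertW x) * exp (LambertW x)) by reflexivity.
pose proof (exp_pos (LambertW x)).
replace (LambertW x / (x * (1 + LambertW x))) with
  (1 / derive_pt f (LambertW x) (Prf (LambertW x) Hin)).
- apply (derivable_pt_lim_recip_interv f LambertW (x / 2) (2 * x) x Prf);
    [exact C|lra|lra| |].
  + intros y Hy. apply (LambertW_spec y); lra.
  + rewrite DE. apply Rmult_integral_contrapositive; lra.
- rewrite DE. rewrite <- Ew at 4. field. lra.
Qed.

Definition Wpow (b x : R) : R := LambertW (Rpower x b).

(** The elasticity [z W'(z) / W(z)] at [z = x^b].  It is used as
    the coordinate because [x d/dx] maps polynomials in it to polynomials. *)
Definition Welast (b x : R) : R := / (1 + Wpow b x).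

Lemma Wpow_pos b x : 0 < Wpow b x.
Proof. apply (LambertW_spec (Rpower x b)), exp_pos. Qed.

(** The equation [w exp w = x^b] in logarithmic form. *)
Lemma Wpow_log b x : ln (Wpow b x) + Wpow b x = b * ln x.
Proof.
destruct (LambertW_spec (Rpower x b)) as [H E]; [apply exp_pos|].
fold (Wpow b x) in H, E.
rewrite <- (ln_exp (Wpow b x)) at 2.
rewrite <- ln_mult, E by (auto using exp_pos). apply ln_exp.
Qed.

Lemma Welast_bounds b x : 0 < Welast b x < 1.
Proof.
unfold Welast; pose proof (Wpow_pos b x); split.
- apply Rinv_0_lt_compat; lra.
- rewrite <- Rinv_1. apply Rinv_lt_contravar; lra.
Qed.

Lemma one_sub_Welast b x : 1 - Welast b x = Wpow b x * Welast b x.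
Proof. unfold Welast. pose proof (Wpow_pos b x). field. lra. Qed.

Lemma is_derive_Wpow b x :
  0 < x -> is_derive (Wpow b) x (b * ((1 - Welast b x) * / x)).
Proof.
intros Hx. pose proof (Wpow_pos b x).
assert (DR : is_derive (fun y => Rpower y b) x (Rpower x b * (b * / x))).
{ unfold Rpower. auto_derive; [exact Hx|ring]. }
assert (Hp : 0 < Rpower x b) by apply exp_pos.
pose proof (is_derive_comp LambertW (fun y => Rpower y b) x _ _
              (is_derive_LambertW _ Hp) DR) as D.
fold (Wpow b x) in D.
replace (b * ((1 - Welast b x) * / x)) with
  (scal (Rpower x b * (b * / x)) (Wpow b x / (Rpower x b * (1 + Wpow b x)))).
- exact D.
- unfold scal; simpl; unfold mult; simpl; unfold Welast. field. lra.
Qed.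

Lemma is_derive_Welast b x :
  0 < x ->
  is_derive (Welast b) x
    (- (Welast b x * Welast b x * (b * ((1 - Welast b x) * / x)))).
Proof.
intros Hx. pose proof (Wpow_pos b x).
pose proof (is_derive_inv (fun y => 1 + Wpow b y) x
  (b * ((1 - Welast b x) * / x))) as D.
replace (- (Welast b x * Welast b x * (b * ((1 - Welast b x) * / x)))) with
  (- (b * ((1 - Welast b x) * / x)) / (1 + Wpow b x) ^ 2).
- apply D; [|lra].
  replace (b * ((1 - Welast b x) * / x)) with (0 + b * ((1 - Welast b x) * / x)) by ring.
  apply (is_derive_plus (fun _ => 1) (Wpow b)); [|now apply is_derive_Wpow].
  apply @is_derive_const.
- unfold Welast. field. lra.
Qed.

(** * The two closed differential systems *)

Ltac derive_Welast b x Hx :=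
  let D := fresh "D" in
  pose proof (is_derive_Welast b x Hx) as D;
  auto_derive;
  [ repeat split; try (eexists; exact D); try lra
  | rewrite ?(is_derive_unique (fun y : R => Welast b y) _ _ D); field; lra ].

Ltac cm :=
  repeat first
    [ assumption | apply cm_upto_inv | apply cm_upto_const; nra
    | apply cm_upto_plus | apply cm_upto_mult ].

(** The second function is the derivative [E] of [Wpow b]; the system closes
    because [1 - b q^2 = (1 - b) + b (1 - q) (1 + q)]. *)
Lemma cm_upto_Welast_pos b n :
  0 <= b <= 1 ->
  cm_upto n (Welast b) /\ cm_upto n (fun x => b * ((1 - Welast b x) * / x)).
Proof.
intros Hb.
assert (N1 : forall x, 0 < x -> 0 <= Welast b x).
{ intros x _; pose proof (Welast_bounds b x); lra. }
assert (N2 : forall x, 0 < x -> 0 <= b * ((1 - Welast b x) * / x)).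
{ intros x Hx; pose proof (Welast_bounds b x).
  pose proof (Rinv_0_lt_compat x Hx).
  apply Rmult_le_pos; [lra|]. apply Rmult_le_pos; lra. }
induction n as [|n [IH1 IH2]]; [now repeat split|].
split.
- apply cm_upto_step with
    (fun x => Welast b x * Welast b x * (b * ((1 - Welast b x) * / x))); [exact N1| |cm].
  apply is_derive_Welast.
- apply cm_upto_step with (fun x =>
    b * ((1 - Welast b x) * / x)
    * ((1 - b) * / x + b * ((1 - Welast b x) * / x) * (1 + Welast b x)));
    [exact N2| |cm].
  intros x Hx. derive_Welast b x Hx.
Qed.

(** The system closes because
    [1 + 2 b q (1 - q) = (1 + b) - b ((1 - q)^2 + q^2)]. *)
Lemma cm_upto_Welast_neg b n :
  -1 <= b <= 0 ->
  cm_upto n (fun x => 1 - Welast b x) /\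
  cm_upto n (fun x => - b * (Welast b x * Welast b x * / x)).
Proof.
intros Hb.
assert (N1 : forall x, 0 < x -> 0 <= 1 - Welast b x).
{ intros x _; pose proof (Welast_bounds b x); lra. }
assert (N2 : forall x, 0 < x -> 0 <= - b * (Welast b x * Welast b x * / x)).
{ intros x Hx; pose proof (Welast_bounds b x).
  pose proof (Rinv_0_lt_compat x Hx).
  apply Rmult_le_pos; [lra|]. apply Rmult_le_pos; nra. }
induction n as [|n [IH1 IH2]]; [now repeat split|].
split.
- apply cm_upto_step with
    (fun x => - b * (Welast b x * Welast b x * / x) * (1 - Welast b x)); [exact N1| |cm].
  intros x Hx. derive_Welast b x Hx.
- apply cm_upto_step with (fun x =>
    - b * (Welast b x * Welast b x * / x)
    * ((1 + b) * / x + - b * ((1 - Welast b x) * (1 - Welast b x) * / x)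
       + - b * (Welast b x * Welast b x * / x)));
    [exact N2| |cm].
  intros x Hx. derive_Welast b x Hx.
Qed.

(** Minus the logarithmic derivative is [(1 + b q (1 - q)) / x], and
    [1 + b q (1 - q) = (1 + b) - b ((1 - q) + q^2)]. *)
Lemma cm_upto_Welast_div_neg b n :
  -1 <= b <= 0 -> cm_upto n (fun x => Welast b x * / x).
Proof.
intros Hb.
apply cm_upto_of_log_derivative with (fun x =>
  (1 + b) * / x + - b * ((1 - Welast b x) * / x) + - b * (Welast b x * Welast b x * / x)).
- intros x Hx. pose proof (Welast_bounds b x).
  apply Rmult_le_pos; [lra|]. now apply Rlt_le, Rinv_0_lt_compat.
- intros x Hx. derive_Welast b x Hx.
- intros m. destruct (cm_upto_Welast_neg b m Hb). cm.
Qed.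

(** * Monomials in x, W and 1 + W *)

Definition monomial (b l a c x : R) : R :=
  Rpower x l * Rpower (Wpow b x) a * Rpower (1 + Wpow b x) c.

Lemma monomial_pos b l a c x : 0 < monomial b l a c x.
Proof. unfold monomial, Rpower; repeat apply Rmult_lt_0_compat; apply exp_pos. Qed.

Lemma monomial_mul_Welast b l a c x :
  monomial b l a (c - 1) x = monomial b l a c x * Welast b x.
Proof.
pose proof (Wpow_pos b x).
unfold monomial, Rminus.
rewrite Rpower_plus, Rpower_Ropp, Rpower_1 by lra.
unfold Welast; ring.
Qed.

Lemma monomial_mul_one_sub_Welast_div b l a c x :
  0 < x ->
  monomial b (l - 1) (a + 1) (c - 1) x
  = monomial b l a c x * ((1 - Welast b x) * / x).
Proof.
intros Hx. rewrite monomial_mul_Welast, one_sub_Welast. unfold monomial, Rminus.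
rewrite !Rpower_plus, Rpower_Ropp, !Rpower_1 by (exact Hx || apply Wpow_pos).
ring.
Qed.

Lemma is_derive_monomial b l a c x :
  0 < x ->
  is_derive (monomial b l a c) x
    (monomial b l a c x
     * ((l + b * (a * Welast b x + c * (Welast b x * (1 - Welast b x)))) * / x)).
Proof.
intros Hx. pose proof (is_derive_Wpow b x Hx) as D. pose proof (Wpow_pos b x).
unfold monomial, Rpower. auto_derive.
- repeat split; try lra; now exists (b * ((1 - Welast b x) * / x)).
- rewrite ?(is_derive_unique (fun y : R => Wpow b y) _ _ D). unfold Welast. field. lra.
Qed.

Lemma cm_upto_monomial n b l a c h :
  (forall m, cm_upto m h) ->
  (forall x, 0 < x ->
     h x = - ((l + b * (a * Welast b x + c * (Welast b x * (1 - Welast b x)))) * / x)) ->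
  cm_upto n (monomial b l a c).
Proof.
intros Hh E. apply cm_upto_of_log_derivative with h; [| |exact Hh].
- intros x _. apply Rlt_le, monomial_pos.
- intros x Hx. rewrite E by exact Hx.
  rewrite <- Ropp_mult_distr_r, Ropp_involutive. now apply is_derive_monomial.
Qed.

(** Here [b = 1], and the bound [l <= -1] comes from
    [- l - q = (- l - 1) + (1 - q)]. *)
Lemma cm_upto_mul_LambertW n l :
  l <= -1 -> cm_upto n (fun x => Rpower x l * LambertW x).
Proof.
intros Hl. apply cm_upto_ext with (monomial 1 l 1 0).
- intros x Hx. unfold monomial, Wpow. rewrite (Rpower_1 x) by exact Hx.
  rewrite Rpower_1 by (now apply LambertW_spec).
  rewrite Rpower_O by (pose proof (LambertW_spec x Hx); lra). ring.
- apply cm_upto_monomial with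
    (fun x => (- l - 1) * / x + 1 * ((1 - Welast 1 x) * / x)).
  + intros m. destruct (cm_upto_Welast_pos 1 m) as [_ H]; [lra|].
    cm.
  + intros x Hx. ring.
Qed.

Lemma cm_upto_monomial_nonneg n b l a c :
  0 <= a -> 0 <= c -> -1 <= b <= 0 -> l <= 0 -> cm_upto n (monomial b l a c).
Proof.
intros Ha Hc Hb Hl.
apply cm_upto_monomial with (fun x =>
  - l * / x + - b * a * (Welast b x * / x)
  + - b * c * (Welast b x * / x * (1 - Welast b x))).
- intros m. pose proof (cm_upto_Welast_div_neg b m Hb).
  destruct (cm_upto_Welast_neg b m Hb). cm.
- intros x Hx. ring.
Qed.

Lemma cm_upto_monomial_nonpos n b l a c :
  a <= 0 -> c <= 0 -> 0 <= b <= 1 -> l <= 0 -> cm_upto n (monomial b l a c).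
Proof.
intros Ha Hc Hb Hl.
apply cm_upto_monomial with (fun x =>
  - l * / x + - a * b * (Welast b x * / x)
  + - c * (Welast b x * (b * ((1 - Welast b x) * / x)))).
- intros m. destruct (cm_upto_Welast_pos b m Hb). cm.
- intros x Hx. ring.
Qed.

(** Since [ln w + w = b ln x], the left-hand side is
    [exp (- a c w) (1 + w)^(c - 1)]. *)
Lemma monomial_le_1 a b c x :
  0 <= a -> 0 <= c <= 1 -> monomial b (- (a * b * c)) (a * c) (c - 1) x <= 1.
Proof.
intros Ha Hc. unfold monomial, Rpower. rewrite <- !exp_plus.
apply Rle_trans with (exp 0); [|rewrite exp_0; lra].
pose proof (Wpow_pos b x) as Hw. pose proof (Wpow_log b x) as E.
assert (Hln : 0 < ln (1 + Wpow b x)).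
{ rewrite <- ln_1. apply ln_increasing; lra. }
replace (- (a * b * c) * ln x) with (- (a * c) * (ln (Wpow b x) + Wpow b x))
  by (rewrite E; ring).
assert (H : - (a * c) * (ln (Wpow b x) + Wpow b x) + a * c * ln (Wpow b x)
            + (c - 1) * ln (1 + Wpow b x) <= 0).
{ assert (0 <= a * c) by nra.
  assert (0 <= a * c * Wpow b x) by (apply Rmult_le_pos; lra).
  assert (0 <= (1 - c) * ln (1 + Wpow b x)) by (apply Rmult_le_pos; lra).
  lra. }
destruct H as [H|H]; [now apply Rlt_le, exp_increasing|rewrite H; lra].
Qed.

(** With [g] the monomial, nonnegativity is [monomial_le_1], and
    [x g' = - b g (1 - q) (a c + (1 - c) q)]; both [g (1 - q) / x] and
    [g (1 - q) q / x] are again monomials, to which the logarithmic derivative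
    criterion applies. *)
Lemma cm_upto_one_sub_monomial n a b c :
  0 <= a <= 1 -> -1 <= b <= 0 -> 0 <= c <= 1 ->
  cm_upto n (fun x => 1 - monomial b (- (a * b * c)) (a * c) (c - 1) x).
Proof.
intros Ha Hb Hc.
set (l := - (a * b * c) - 1); set (p := a * c + 1).
assert (C1 : cm_upto n (monomial b l p (c - 1 - 1))).
{ apply cm_upto_monomial with (fun x =>
    (1 + b) * / x + - b * (1 - a * c) * ((1 - Welast b x) * / x)
    + - b * c * (Welast b x * / x)
    + (2 - c) * (- b * (Welast b x * Welast b x * / x))).
  - intros m. pose proof (cm_upto_Welast_div_neg b m Hb).
    destruct (cm_upto_Welast_neg b m Hb). cm.
  - intros x _. unfold l, p. ring. }
assert (C2 : cm_upto n (monomial b l p (c - 1 - 1 - 1))).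
{ (* Minus the logarithmic derivative, times [x], is [1 + b - b r] with
     [r = (1 - a c) - (2 - c - a c) q + (3 - c) q^2].  The coefficient of [q]
     has the wrong sign; extracting [(1 - a c) (1 - q)^2] leaves
     [c (1 - a) q + (2 - c (1 - a)) q^2], and this is where [a <= 1] enters. *)
  apply cm_upto_monomial with (fun x =>
    (1 + b) * / x
    + - b * (1 - a * c) * ((1 - Welast b x) * (1 - Welast b x) * / x)
    + - b * (c * (1 - a)) * (Welast b x * / x)
    + (2 - c * (1 - a)) * (- b * (Welast b x * Welast b x * / x))).
  - intros m. pose proof (cm_upto_Welast_div_neg b m Hb).
    destruct (cm_upto_Welast_neg b m Hb). cm.
  - intros x _. unfold l, p. ring. }
apply cm_upto_pred, cm_upto_step with (fun x =>
  - b * (a * c) * monomial b l p (c - 1 - 1) x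
  + - b * (1 - c) * monomial b l p (c - 1 - 1 - 1) x); [| |cm].
- intros x _. pose proof (monomial_le_1 a b c x (proj1 Ha) Hc). lra.
- intros x Hx. unfold l, p.
  rewrite (monomial_mul_Welast _ _ _ (c - 1 - 1)), monomial_mul_one_sub_Welast_div by exact Hx.
  replace (- (_ + _)) with
    (0 - monomial b (- (a * b * c)) (a * c) (c - 1) x
     * ((- (a * b * c) + b * (a * c * Welast b x
         + (c - 1) * (Welast b x * (1 - Welast b x)))) * / x))
    by ring.
  apply (is_derive_minus (fun _ => 1)); [apply @is_derive_const|].
  now apply is_derive_monomial.
Qed.

Theorem theorem4p4 :
  (forall lambda : R, lambda <= -1 ->
     completely_monotonic (fun x => Rpower x lambda * LambertW x))
  /\
  (forall alpha beta gamma lambda : R,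
     0 <= alpha -> 0 <= gamma -> -1 <= beta <= 0 -> lambda <= 0 ->
     completely_monotonic (fun x =>
       Rpower x lambda * Rpower (LambertW (Rpower x beta)) alpha
       * Rpower (1 + LambertW (Rpower x beta)) gamma))
  /\
  (forall alpha beta gamma lambda : R,
     alpha <= 0 -> gamma <= 0 -> -1 <= beta <= 0 -> lambda <= 0 ->
     completely_monotonic (fun x =>
       Rpower x lambda * Rpower (LambertW (Rpower x (- beta))) alpha
       * Rpower (1 + LambertW (Rpower x (- beta))) gamma))
  /\
  (forall alpha beta gamma : R,
     0 <= alpha <= 1 -> -1 <= beta <= 0 -> 0 <= gamma <= 1 ->
     completely_monotonic (fun x =>
       1 - Rpower x (- (alpha * beta * gamma))
           * Rpower (LambertW (Rpower x beta)) (alpha * gamma)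
           * Rpower (1 + LambertW (Rpower x beta)) (gamma - 1))).
Proof.
split; [|split; [|split]].
- intros lambda Hl. apply completely_monotonic_of_cm_upto; intros n.
  now apply cm_upto_mul_LambertW.
- intros alpha beta gamma lambda Ha Hg Hb Hl.
  apply completely_monotonic_of_cm_upto; intros n.
  now apply (cm_upto_monomial_nonneg n beta).
- intros alpha beta gamma lambda Ha Hg Hb Hl.
  apply completely_monotonic_of_cm_upto; intros n.
  apply (cm_upto_monomial_nonpos n (- beta)); lra.
- intros alpha beta gamma Ha Hb Hg.
  apply completely_monotonic_of_cm_upto; intros n.
  now apply (cm_upto_one_sub_monomial n alpha beta gamma).
Qed.
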